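(* The assignment that sends each fanning curve $\ell(t)$ in $\mathrm{G}_n$ to its horizontal curve $h(t)$ is characterized by the following four properties; that is, it satisfies all four, and it is the only assignment $\ell(t)\mapsto h(t)$ of a curve of $n$-dimensional subspaces of $\mathbb{R}^{2n}$ to each fanning curve that satisfies all four: 1. At each time $t$ the subspace $h(t)$ is transversal to $\ell(t)$. 2. The subspace $h(\tau)$ depends only on the two-jet of the curve $\ell(t)$ at $t=\tau$. 3. If $\mathbf{T}$ is an invertible linear transformation of $\mathbb{R}^{2n}$, the curve assigned to $\mathbf{T}\ell(t)$ is $\mathbf{T}h(t)$. 4. If $\ell(t)$ is spanned by a line $\mathcal{A}+t\mathcal{B}$ in the space of frames (with $(\mathcal{A}|\mathcal{B})$ invertible), then $h(t)$ is constant.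
   Context: $\mathrm{G}_n$ is the Grassmannian of $n$-dimensional subspaces of $\mathbb{R}^{2n}$. For $2n\times n$ matrices $\mathcal{A},\mathcal{B}$, $(\mathcal{A}|\mathcal{B})$ is the $2n\times 2n$ matrix obtained by juxtaposition. A fanning frame is a smooth curve $\mathcal{A}(t)$, $t\in\mathbb{R}$, of real $2n\times n$ matrices such that $(\mathcal{A}(t)|\dot{\mathcal{A}}(t))$ is invertible for all $t$. A fanning curve in $\mathrm{G}_n$ is a smooth curve $\ell(t)$ that is the column span of a fanning frame; two fanning frames $\mathcal{A}(t),\mathcal{B}(t)$ span the same curve iff $\mathcal{B}(t)=\mathcal{A}(t)X(t)$ for a smooth curve $X(t)$ of invertible $n\times n$ matrices. The fundamental endomorphism of $\ell(t)$ is the curve $\mathbf{F}(t)$ of $2n\times 2n$ matrices determined by $\mathbf{F}(t)\mathcal{A}(t)=O$, $\mathbf{F}(t)\dot{\mathcal{A}}(t)=\mathcal{A}(t)$ for any fanning frame $\mathcal{A}(t)$ spanning $\ell(t)$ (it does not depend on the frame). One has $\dot{\mathbf{F}}(t)^2=\mathbf{I}$, and the $-1$ eigenspace of $\dot{\mathbf{F}}(t)$ is $\ell(t)$. The horizontal curve $h(t)$ of $\ell(t)$ is the $+1$ eigenspace of $\dot{\mathbf{F}}(t)$, i.e. the kernel of the projection $\mathbf{P}(t)=(\mathbf{I}-\dot{\mathbf{F}}(t))/2$. Two-jets: the space of two-jets of fanning frames is the set of triples $(\mathcal{A},\dot{\mathcal{A}},\ddot{\mathcal{A}})$ of $2n\times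 n$ matrices with $(\mathcal{A}|\dot{\mathcal{A}})$ invertible; the space $J^2_f(\mathbb{R};\mathrm{G}_n)$ of two-jets of fanning curves is its quotient by the identifications $(\mathcal{A},\dot{\mathcal{A}},\ddot{\mathcal{A}})\sim(\mathcal{A}X,\dot{\mathcal{A}}X+\mathcal{A}\dot X,\ddot{\mathcal{A}}X+2\dot{\mathcal{A}}\dot X+\mathcal{A}\ddot X)$, with $X,\dot X,\ddot X$ any $n\times n$ matrices and $X$ invertible. The two-jet of $\ell(t)$ at $\tau$ is the class of $(\mathcal{A}(\tau),\dot{\mathcal{A}}(\tau),\ddot{\mathcal{A}}(\tau))$ for any fanning frame spanning $\ell(t)$. Property 2 means that there is a map $j:J^2_f(\mathbb{R};\mathrm{G}_n)\to \mathrm{G}_n$ such that $h(\tau)$ is the value of $j$ at the two-jet of $\ell(t)$ at $\tau$, for every fanning curve $\ell(t)$ and every $\tau$. *)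

(* Defs.v *)
From HB Require Import structures.
From mathcomp Require Import all_boot all_order all_algebra.
From mathcomp Require Import all_classical all_reals all_analysis.
From mathcomp Require Import ring.

Set Implicit Arguments.
Unset Strict Implicit.
Unset Printing Implicit Defensive.

Import Order.TTheory GRing.Theory Num.Theory.
Import numFieldNormedType.Exports.

Local Open Scope ring_scope.
Local Open Scope quotient_scope.

Definition smooth_curve (R : realType) (V : normedModType R) (f : R -> V) : Prop :=
  forall (k : nat) (t : R), derivable (derive1n k f) t 1.

Definition colspan (R : realType) (m p : nat) (A : 'M[R]_(m, p)) :
    {vspace 'cV[R]_m} :=
  limg (linfun (mulmx A : 'cV[R]_p -> 'cV[R]_m)).

Definition matrix_endo (R : realType) (m : nat) (T : 'M[R]_m) : 'End('cV[R]_m) :=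
  linfun (mulmx T : 'cV[R]_m -> 'cV[R]_m).

Definition grassmannian (R : realType) (n : nat) : Type :=
  {V : {vspace 'cV[R]_(n + n)} | \dim V == n}.

Record fanning_frame (R : realType) (n : nat) : Type := FanningFrame {
  frame_fun :> R -> 'M[R]_(n + n, n);
  frame_smooth : smooth_curve frame_fun;
  frame_fanning : forall t : R, row_mx (frame_fun t) (derive1 frame_fun t) \in unitmx
}.

Definition spans (R : realType) (n : nat) (A : R -> 'M[R]_(n + n, n))
    (l : R -> grassmannian R n) : Prop :=
  forall t : R, val (l t) = colspan (A t).

Record fanning_curve (R : realType) (n : nat) : Type := FanningCurve {
  curve_fun :> R -> grassmannian R n;
  curve_fanning : exists A : fanning_frame R n, spans A curve_fun
}.

(* [row_mx (A t) (A' t)] is invertible and every fanning curve is spanned by some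
   frame, so these equations admit at most one [F]. *)
Definition is_fundamental_endomorphism (R : realType) (n : nat)
    (l : fanning_curve R n) (F : R -> 'M[R]_(n + n)) : Prop :=
  forall A : fanning_frame R n, spans A l ->
  forall t : R, F t *m A t = 0 /\ F t *m derive1 A t = A t.

Definition is_horizontal_curve (R : realType) (n : nat)
    (l : fanning_curve R n) (h : R -> grassmannian R n) : Prop :=
  exists2 F : R -> 'M[R]_(n + n), is_fundamental_endomorphism l F &
    forall t : R, val (h t) = passmx.leigenspace (matrix_endo (derive1 F t)) 1.

Definition frame_two_jet (R : realType) (n : nat) : Type :=
  {J : 'M[R]_(n + n, n) * 'M[R]_(n + n, n) * 'M[R]_(n + n, n)
     | row_mx J.1.1 J.1.2 \in unitmx}.

(* First- and second-order Leibniz rule for [A t *m X t]; [X], [X1], [X2] stand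
   for the value and the first two derivatives of [X]. *)
Definition two_jet_equiv (R : realType) (n : nat) (J K : frame_two_jet R n) : bool :=
  `[< exists X X1 X2 : 'M[R]_n,
      X \in unitmx /\
      val K = ((val J).1.1 *m X,
               (val J).1.2 *m X + (val J).1.1 *m X1,
               (val J).2 *m X + ((val J).1.2 *m X1) *+ 2 + (val J).1.1 *m X2) >].

Lemma two_jet_equiv_refl (R : realType) (n : nat) :
  reflexive (@two_jet_equiv R n).
Proof.
move=> [[[A B] C] hJ]; apply/asboolP; exists 1%:M, 0, 0.
by rewrite unitmx1 /= !mulmx1 !mulmx0 mul0rn !addr0.
Qed.

Lemma two_jet_equiv_trans (R : realType) (n : nat) :
  transitive (@two_jet_equiv R n).
Proof.
move=> [[[A' B'] C'] hK] [[[A B] C] hJ] [[[A'' B''] C''] hL] /asboolP /=.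
move=> [X [X1 [X2 [uX [eA eB eC]]]]] /asboolP /= [Y [Y1 [Y2 [uY [eA' eB' eC']]]]].
apply/asboolP => /=.
exists (X *m Y), (X1 *m Y + X *m Y1), (X2 *m Y + (X1 *m Y1) *+ 2 + X *m Y2).
rewrite unitmx_mul uX uY; split=> //.
rewrite eA' eB' eC' eA eB eC !(mulmxDl, mulmxDr, mulr2n, mulmxA).
congr (_, _, _); first by rewrite addrA.
apply/matrixP => i j; rewrite !mxE; ring.
Qed.

Lemma two_jet_equiv_symP (R : realType) (n : nat) (J K : frame_two_jet R n) :
  two_jet_equiv J K -> two_jet_equiv K J.
Proof.
case: J K => [[[A B] C] hJ] [[[A' B'] C'] hK] /asboolP /=.
move=> [X [X1 [X2 [uX [eA eB eC]]]]]; apply/asboolP => /=.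
pose Y := invmx X; pose Y1 := - (Y *m X1 *m Y).
exists Y, Y1, (- (Y *m (X2 *m Y + (X1 *m Y1) *+ 2))).
rewrite unitmx_inv uX; split=> //.
have AXY (D : 'M[R]_(n + n, n)) : D *m X *m Y = D by rewrite mulmxK.
rewrite eA eB eC; congr (_, _, _).
- by rewrite AXY.
- by rewrite mulmxDl AXY /Y1 mulmxN !mulmxA AXY addrK.
- rewrite /Y1 !(mulmxDl, mulmxDr, mulr2n, mulmxN, mulmxA, AXY).
  by apply/matrixP => i j; rewrite !mxE; ring.
Qed.

Lemma two_jet_equiv_sym (R : realType) (n : nat) :
  symmetric (@two_jet_equiv R n).
Proof. by move=> J K; apply/idP/idP; apply: two_jet_equiv_symP. Qed.

Canonical two_jet_equiv_rel (R : realType) (n : nat) :=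
  EquivRel (@two_jet_equiv R n) (@two_jet_equiv_refl R n)
    (@two_jet_equiv_sym R n) (@two_jet_equiv_trans R n).

Definition two_jet (R : realType) (n : nat) : Type :=
  {eq_quot @two_jet_equiv_rel R n}.

Definition frame_two_jet_at (R : realType) (n : nat) (A : fanning_frame R n) (t : R) :
    frame_two_jet R n :=
  exist _ (A t, derive1 A t, derive1n 2 A t) (frame_fanning A t).

Definition frame_jet_class (R : realType) (n : nat) (A : fanning_frame R n) (t : R) :
    two_jet R n :=
  \pi_({eq_quot @two_jet_equiv_rel R n}) (frame_two_jet_at A t).

(* No regularity of the assigned curves is required. *)
Definition assignment (R : realType) (n : nat) : Type :=
  fanning_curve R n -> R -> grassmannian R n.

(* Both subspaces have half the ambient dimension, so their sum is everything
   exactly when it is direct. *)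
Definition transversality (R : realType) (n : nat) (h : assignment R n) : Prop :=
  forall (l : fanning_curve R n) (t : R), (val (h l t) + val (l t) = fullv)%VS.

Definition two_jet_dependence (R : realType) (n : nat) (h : assignment R n) : Prop :=
  exists j : two_jet R n -> grassmannian R n,
    forall (l : fanning_curve R n) (A : fanning_frame R n), spans A l ->
    forall t : R, h l t = j (frame_jet_class A t).

(* [Tl] is the image curve of [l] under [T]; it is again a fanning curve, spanned
   by [T *m A t] when [A] spans [l]. *)
Definition linear_equivariance (R : realType) (n : nat) (h : assignment R n) : Prop :=
  forall T : 'M[R]_(n + n), T \in unitmx ->
  forall l Tl : fanning_curve R n,
    (forall t : R, val (Tl t) = (matrix_endo T @: val (l t))%VS) ->
  forall t : R, val (h Tl t) = (matrix_endo T @: val (h l t))%VS.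

Definition constant_on_lines (R : realType) (n : nat) (h : assignment R n) : Prop :=
  forall A B : 'M[R]_(n + n, n), row_mx A B \in unitmx ->
  forall l : fanning_curve R n, spans (fun t : R => A + t *: B) l ->
  forall s t : R, h l s = h l t.

Definition four_properties (R : realType) (n : nat) (h : assignment R n) : Prop :=
  [/\ transversality h, two_jet_dependence h, linear_equivariance h
    & constant_on_lines h].

(* Main.v *)
Require Import Defs.
From mathcomp Require Import all_boot all_order all_algebra.
From mathcomp Require Import all_classical all_reals all_analysis.
From mathcomp Require Import ring.

(* Write A'' = A P + A' Q.  The fundamental endomorphism is
   F = (0 | A) (A | A')^-1, and differentiating F A = 0 and F A' = A gives
   F' A = - A and F' A' = A' - A Q; hence the +1 eigenspace of F' is spanned by
   H = A' - A Q / 2, which depends only on the two-jet.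

   For uniqueness, reparametrising the frame turns the two-jet (A, A', A'') into
   (A, H, 0), the two-jet at 0 of the line A + s H.  On a line B0 + s B1 an
   assignment satisfying the four properties takes a constant value, transversal
   to span B0 and so of the form span (B0 S + B1).  Invariance under the maps
   B0 |-> B0 X, B1 |-> B1 X, which preserve the line, makes S commute with every
   invertible X; transversality to B0 + s B1 makes 1 - s S invertible for all s.
   Together these force S = 0, so the value is span B1. *)

Set Implicit Arguments.
Unset Strict Implicit.
Unset Printing Implicit Defensive.

Import Order.TTheory GRing.Theory Num.Theory.
Import numFieldNormedType.Exports.

Local Open Scope ring_scope.
Local Open Scope quotient_scope.

(** * Derivatives of matrix-valued functions *)

Lemma is_derive_mxP (R : realFieldType) (V : normedModType R) (m p : nat)
    (M : V -> 'M[R]_(m, p)) (t v : V) (D : 'M[R]_(m, p)) :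
  is_derive t v M D <->
  forall i j, is_derive t v (fun x => M x i j) (D i j).
Proof.
split=> [[Mt <-] i j|MD].
  have Mij : derivable (fun x => M x i j) t v by move/derivable_mxP: Mt.
  by rewrite derive_mx// mxE; apply: derivableP.
have Mt : derivable M t v by apply/derivable_mxP => i j; have [] := MD i j.
apply: DeriveDef => //; rewrite derive_mx//; apply/matrixP => i j.
by rewrite mxE; have [] := MD i j.
Qed.

Lemma is_derive_mulmx (R : realFieldType) (V : normedModType R) (m p q : nat)
    (M : V -> 'M[R]_(m, p)) (N : V -> 'M[R]_(p, q)) (t v : V) M' N' :
  is_derive t v M M' -> is_derive t v N N' ->
  is_derive t v (fun x => M x *m N x) (M' *m N t + M t *m N').
Proof.
move=> /is_derive_mxP dM /is_derive_mxP dN; apply/is_derive_mxP => i j.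
rewrite (_ : (fun x => _) =
    \sum_(k < p) ((fun x => M x i k) * (fun x => N x k j))); last first.
  by apply/funext => x; rewrite mxE fct_sumE.
apply: is_derive_eq; rewrite !mxE -big_split; apply: eq_bigr => k _ /=.
by rewrite addrC /GRing.scale /= [N t k j * _]mulrC.
Qed.

Lemma is_derive_mulmxr (R : realFieldType) (V : normedModType R) (m p q : nat)
    (C : 'M[R]_(m, p)) (N : V -> 'M[R]_(p, q)) (t v : V) N' :
  is_derive t v N N' -> is_derive t v (fun x => C *m N x) (C *m N').
Proof.
move=> dN; have := is_derive_mulmx (is_derive_cst C t v) dN.
by rewrite mul0mx add0r.
Qed.

Lemma is_derive_row_mx (R : realFieldType) (V : normedModType R) (m p q : nat)
    (M : V -> 'M[R]_(m, p)) (N : V -> 'M[R]_(m, q)) (t v : V) M' N' :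
  is_derive t v M M' -> is_derive t v N N' ->
  is_derive t v (fun x => row_mx (M x) (N x)) (row_mx M' N').
Proof.
move=> /is_derive_mxP dM /is_derive_mxP dN; apply/is_derive_mxP => i j.
rewrite mxE; case: (split_ordP j) => k ->.
  by under eq_fun do rewrite row_mxEl.
by under eq_fun do rewrite row_mxEr.
Qed.

Lemma derivable_prod (R : realFieldType) (V : normedModType R) (I : Type)
    (r : seq I) (f : I -> V -> R) (t v : V) :
  (forall i, derivable (f i) t v) ->
  derivable (fun x => \prod_(i <- r) f i x) t v.
Proof.
move=> df; elim: r => [|i r IH].
  by under eq_fun do rewrite big_nil; apply: derivable_cst.
by under eq_fun do rewrite big_cons; apply: derivableM.
Qed.

Lemma derivable_sumr (R : realFieldType) (V : normedModType R) (I : Type)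
    (r : seq I) (f : I -> V -> R) (t v : V) :
  (forall i, derivable (f i) t v) ->
  derivable (fun x => \sum_(i <- r) f i x) t v.
Proof.
move=> df; elim: r => [|i r IH].
  by under eq_fun do rewrite big_nil; apply: derivable_cst.
by under eq_fun do rewrite big_cons; apply: derivableD.
Qed.

Lemma derivable_det (R : realFieldType) (V : normedModType R) (m : nat)
    (M : V -> 'M[R]_m) (t v : V) :
  derivable M t v -> derivable (fun x => \det (M x)) t v.
Proof.
move=> /derivable_mxP dM; apply: derivable_sumr => s.
apply: derivableM; first exact: derivable_cst.
exact: derivable_prod.
Qed.

Lemma derivable_invmx (R : realFieldType) (V : normedModType R) (m : nat)
    (M : V -> 'M[R]_m) (t v : V) :
  (forall x, M x \in unitmx) -> derivable M t v ->
  derivable (fun x => invmx (M x)) t v.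
Proof.
move=> uM dM; apply/derivable_mxP => i j.
(* [invmx] is defined by cases, but [M x] is invertible for every [x], so the adjugate formula holds
   identically in [x]. This reduces the claim to determinants of [M] and of its minors. *)
rewrite (_ : (fun x => _) = fun x => (\det (M x))^-1 *
   ((-1) ^+ (j + i) * \det (row' j (col' i (M x))))); last first.
  by apply/funext => x; rewrite /invmx uM !mxE.
apply: derivableM.
  apply: derivableV; last exact: derivable_det.
  by have := uM t; rewrite unitmxE unitfE.
apply: derivableM; first exact: derivable_cst.
apply: derivable_det; apply/derivable_mxP => k l.
rewrite (_ : (fun x => _) = fun x => M x (lift j k) (lift i l)).
  by move/derivable_mxP: dM.
by apply/funext => x; rewrite !mxE.
Qed.

(** * Column spans *)

Lemma memv_colspan (R : realType) (m p : nat) (A : 'M[R]_(m, p)) (v : 'cV_m) :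
  reflect (exists u, v = A *m u) (v \in colspan A).
Proof.
apply: (iffP memv_imgP) => [[u _ ->]|[u ->]]; exists u; rewrite ?memvf//;
  by rewrite lfunE.
Qed.

Lemma colspanS (R : realType) (m p q : nat) (A : 'M[R]_(m, p))
    (B : 'M[R]_(m, q)) :
  reflect (exists X, A = B *m X) (colspan A <= colspan B)%VS.
Proof.
apply: (iffP subvP) => [sAB|[X ->] v /memv_colspan[u ->]]; last first.
  by apply/memv_colspan; exists (X *m u); rewrite mulmxA.
(* Each column of [A] has a coordinate vector with respect to [B]; the chosen vectors become the
   columns of [X]. The boolean equality makes [xchoose] applicable. *)
have colP j : exists u : 'cV_q, (col j A == B *m u).
  have /sAB/memv_colspan[u ->] : col j A \in colspan A; last by exists u.
  by apply/memv_colspan; exists (delta_mx j 0); rewrite colE.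
exists (\matrix_(i < q, j < p) (xchoose (colP j) i 0)); apply/matrixP => i j.
have /eqP/matrixP/(_ i 0) := xchooseP (colP j).
by rewrite !mxE => ->; apply: eq_bigr => k _; rewrite mxE.
Qed.

Lemma colspan_mulmxr (R : realType) (m p : nat) (A : 'M[R]_(m, p)) (X : 'M[R]_p) :
  X \in unitmx -> colspan (A *m X) = colspan A.
Proof.
move=> uX; apply/eqP; rewrite eqEsubv; apply/andP; split; apply/colspanS.
  by exists X.
by exists (invmx X); rewrite mulmxK.
Qed.

Lemma colspan_row_mx (R : realType) (m p q : nat) (A : 'M[R]_(m, p))
    (B : 'M[R]_(m, q)) :
  colspan (row_mx A B) = (colspan A + colspan B)%VS.
Proof.
apply/vspaceP => v; apply/memv_colspan/memv_addP => [[u ->]|[x]].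
  rewrite -(vsubmxK u) mul_row_col; exists (A *m usubmx u).
    by apply/memv_colspan; exists (usubmx u).
  by exists (B *m dsubmx u) => //; apply/memv_colspan; exists (dsubmx u).
move=> /memv_colspan[a ->] [y /memv_colspan[b ->] ->].
by exists (col_mx a b); rewrite mul_row_col.
Qed.

Lemma colspan_full (R : realType) (m : nat) (M : 'M[R]_m) :
  (colspan M == fullv) = (M \in unitmx).
Proof.
rewrite eqEsubv subvf /=; apply/idP/idP => [/subvP fM|uM].
  have /colspanS[X M1] : (colspan (1%:M : 'M[R]_m) <= colspan M)%VS.
    by apply/subvP => v _; apply: fM; rewrite memvf.
  by have /esym/mulmx1_unit[] := M1.
by apply/subvP => v _; apply/memv_colspan; exists (invmx M *m v); rewrite mulKVmx.
Qed.

Lemma dim_colspan (R : realType) (m p : nat) (A : 'M[R]_(m, p)) (L : 'M[R]_(p, m)) :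
  L *m A = 1%:M -> \dim (colspan A) = p.
Proof.
move=> LA; rewrite limg_dim_eq; first by rewrite dimvf; exact: muln1.
apply/eqP; rewrite -subv0; apply/subvP => u; rewrite memv_cap memv_ker memv0.
case/andP=> _; rewrite lfunE /= => /eqP Au.
by rewrite -(mul1mx u) -LA -mulmxA Au mulmx0.
Qed.

Lemma dim_colspan_rsub (R : realType) (m p : nat) (A : 'M[R]_(m + p, m))
    (B : 'M[R]_(m + p, p)) :
  row_mx A B \in unitmx -> \dim (colspan B) = p.
Proof.
move=> uM; apply: (@dim_colspan _ _ _ _ (dsubmx (invmx (row_mx A B)))).
(* The lower block of the inverse is a left inverse of [B]: this is the lower right block of the
   identity [L *m row_mx A B = 1]. *)
have := mulVmx uM; set L := invmx _.
rewrite -[L]vsubmxK mul_col_row scalar_mx_block => /eq_block_mx[_ _ _ <-].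
by rewrite col_mxKd.
Qed.

Lemma dim_colspan_lsub (R : realType) (m p : nat) (A : 'M[R]_(m + p, m))
    (B : 'M[R]_(m + p, p)) :
  row_mx A B \in unitmx -> \dim (colspan A) = m.
Proof.
move=> uM; apply: (@dim_colspan _ _ _ _ (usubmx (invmx (row_mx A B)))).
have := mulVmx uM; set L := invmx _.
rewrite -[L]vsubmxK mul_col_row scalar_mx_block => /eq_block_mx[<- _ _ _].
by rewrite col_mxKu.
Qed.

(** Gives a matrix for the value of an arbitrary assignment, of which only the dimension is known in
    advance. *)
Lemma colspan_of_vspace (R : realType) (m p : nat) (W : {vspace 'cV[R]_m}) :
  \dim W = p -> exists C : 'M[R]_(m, p), colspan C = W.
Proof.
move=> <-; exists (\matrix_(i, j) (vbasis W)`_j i 0).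
have colj (u : 'cV[R]_(\dim W)) :
    (\matrix_(i < m, j < \dim W) (vbasis W)`_j i 0) *m u =
    \sum_(j < \dim W) u j 0 *: (vbasis W)`_j.
  apply/matrixP => i k; rewrite ord1 summxE !mxE.
  by apply: eq_bigr => j _; rewrite !mxE mulrC.
apply/vspaceP => v; apply/memv_colspan/idP => [[u ->]|vW].
  rewrite colj; apply: memv_suml => j _; apply/memvZ/vbasis_mem.
  by rewrite mem_nth ?size_tuple.
exists (\col_j coord (vbasis W) j v); rewrite colj [LHS](coord_vbasis vW).
by apply: eq_bigr => j _; rewrite mxE.
Qed.

Lemma matrix_endo_colspan (R : realType) (m p : nat) (T : 'M[R]_m)
    (A : 'M[R]_(m, p)) :
  (matrix_endo T @: colspan A)%VS = colspan (T *m A).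
Proof.
rewrite -limg_comp; congr (_ @: _)%VS; apply/lfunP => u.
by rewrite comp_lfunE !lfunE /= mulmxA.
Qed.

Lemma memv_leigenspace1 (R : realType) (m : nat) (T : 'M[R]_m) v :
  (v \in passmx.leigenspace (matrix_endo T) 1) = (T *m v == v).
Proof.
by rewrite memv_ker !lfun_simp /= scale1r subr_eq0.
Qed.

(** * Horizontal frames and the fundamental endomorphism *)

Section HorizontalFrame.
Variables (R : realType) (n : nat).
Implicit Types A B : 'M[R]_(n + n, n).

(** The [dsubmx] term is the coefficient [Q] in [A2 = A *m P + A1 *m Q]. Writing it through [invmx]
    makes the formula total, with no invertibility proof among its arguments. *)
Definition horizontal_frame A A1 A2 :=
  A1 - 2^-1 *: (A *m dsubmx (invmx (row_mx A A1) *m A2)).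

Lemma horizontal_frameE A A1 A2 (P Q : 'M[R]_n) : row_mx A A1 \in unitmx ->
  A2 = A *m P + A1 *m Q ->
  horizontal_frame A A1 A2 = A1 - 2^-1 *: (A *m Q).
Proof.
by move=> uM ->; rewrite /horizontal_frame -mul_row_col mulKmx// col_mxKd.
Qed.

Lemma row_mx_decomp A A1 B : row_mx A A1 \in unitmx ->
  exists P Q : 'M[R]_n, B = A *m P + A1 *m Q.
Proof.
move=> uM; pose C := invmx (row_mx A A1) *m B.
exists (usubmx C), (dsubmx C).
by rewrite -mul_row_col vsubmxK mulKVmx.
Qed.

Lemma row_mx_horizontal_unit A A1 (Q : 'M[R]_n) : row_mx A A1 \in unitmx ->
  row_mx A (A1 - 2^-1 *: (A *m Q)) \in unitmx.
Proof.
move=> uM; have -> : row_mx A (A1 - 2^-1 *: (A *m Q)) =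
    row_mx A A1 *m block_mx 1%:M (- (2^-1 *: Q)) 0 1%:M.
  by rewrite mul_row_block !mulmx1 mulmx0 addr0 mulmxN -scalemxAr addrC.
by rewrite unitmx_mul uM unitmxE det_ublock !det1 mulr1 unitr1.
Qed.

(** Serves twice: it gives the horizontal space dimension [n], and it makes that space transversal
    to the span of [A]. *)
Lemma row_mx_horizontal_frame_unit A A1 A2 : row_mx A A1 \in unitmx ->
  row_mx A (horizontal_frame A A1 A2) \in unitmx.
Proof. exact: row_mx_horizontal_unit. Qed.

Lemma horizontal_frame_mulmx (T : 'M[R]_(n + n)) A A1 A2 :
  T \in unitmx -> row_mx A A1 \in unitmx ->
  horizontal_frame (T *m A) (T *m A1) (T *m A2) = T *m horizontal_frame A A1 A2.
Proof.
move=> uT uM; have [P [Q A2E]] := row_mx_decomp A2 uM.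
rewrite (horizontal_frameE uM A2E) (@horizontal_frameE _ _ _ P Q).
- by rewrite mulmxBr -scalemxAr mulmxA.
- by rewrite -mul_mx_row unitmx_mul uT.
- by rewrite A2E mulmxDr !mulmxA.
Qed.

(** The new coefficient satisfies [X Q' = Q X + 2 X1], so subtracting half of [A X Q'] removes
    exactly the term [A X1] that the Leibniz rule adds to the first derivative. The factor 1/2 is
    chosen for this cancellation. *)
Lemma horizontal_frame_change A A1 A2 (X X1 X2 : 'M[R]_n) :
  row_mx A A1 \in unitmx -> X \in unitmx ->
  horizontal_frame (A *m X) (A1 *m X + A *m X1)
    (A2 *m X + (A1 *m X1) *+ 2 + A *m X2) =
  horizontal_frame A A1 A2 *m X.
Proof.
move=> uM uX; have [P [Q A2E]] := row_mx_decomp A2 uM.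
(* [Q'] and [P'] solve [A2 X + 2 A1 X1 + A X2 = (A X) P' + (A1 X + A X1) Q']: compare first the
   coefficients of [A1], then those of [A]. *)
pose Q' := invmx X *m (Q *m X + X1 *+ 2).
pose P' := invmx X *m (P *m X + X2 - X1 *m Q').
have XQ' : X *m Q' = Q *m X + X1 *+ 2 by rewrite mulKVmx.
have XP' : X *m P' = P *m X + X2 - X1 *m Q' by rewrite mulKVmx.
clearbody P' Q'; rewrite (horizontal_frameE uM A2E) (@horizontal_frameE _ _ _ P' Q').
- rewrite -mulmxA XQ' mulmxBl -scalemxAl mulmxDr mulmxA mulr2n mulmxDr.
  by apply/matrixP => i j; rewrite !mxE; field.
- have -> : row_mx (A *m X) (A1 *m X + A *m X1) =
      row_mx A A1 *m block_mx X X1 0 X.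
    by rewrite mul_row_block mulmx0 addr0 addrC.
  rewrite unitmx_mul uM unitmxE det_ublock unitrM.
  by move: uX; rewrite unitmxE => ->.
- rewrite mulmxDl -!mulmxA XQ' XP' A2E.
  rewrite !(mulmxDl, mulmxDr, mulmxN, mulmxA, mulr2n).
  by apply/matrixP => i j; rewrite !mxE; ring.
Qed.

End HorizontalFrame.

Lemma horizontal_space_subproof (R : realType) (n : nat) (J : frame_two_jet R n) :
  \dim (colspan (horizontal_frame (val J).1.1 (val J).1.2 (val J).2)) == n.
Proof.
by apply/eqP/dim_colspan_rsub/row_mx_horizontal_frame_unit; exact: valP J.
Qed.

Definition horizontal_space (R : realType) (n : nat) (J : frame_two_jet R n) :
    grassmannian R n :=
  exist _ (colspan (horizontal_frame (val J).1.1 (val J).1.2 (val J).2))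
    (horizontal_space_subproof J).

Lemma horizontal_space_equiv (R : realType) (n : nat) (J K : frame_two_jet R n) :
  two_jet_equiv J K -> horizontal_space J = horizontal_space K.
Proof.
case: J K => [[[A A1] A2] uM] [K uK] /asboolP[X [X1 [X2 [uX /= KE]]]].
apply: val_inj => /=; rewrite KE /= horizontal_frame_change ?colspan_mulmxr//.
Qed.

(** * The fundamental endomorphism and the eigenspace of its derivative *)

Section FundamentalEndomorphism.
Variables (R : realType) (n : nat).
Implicit Types (A B : fanning_frame R n) (l : fanning_curve R n) (t : R).

Lemma is_derive_frame A t : is_derive t 1 A (derive1 A t).
Proof.
by rewrite derive1E; apply: derivableP; have := @frame_smooth _ _ A 0 t.
Qed.

Lemma is_derive_frame1 A t : is_derive t 1 (derive1 A) (derive1n 2 A t).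
Proof.
by rewrite derive1nS derive1E derive1n1; apply: derivableP;
  have := @frame_smooth _ _ A 1 t.
Qed.

Lemma is_derive_frame_jet A t :
  is_derive t 1 (fun x => row_mx (A x) (derive1 A x))
    (row_mx (derive1 A t) (derive1n 2 A t)).
Proof. exact: is_derive_row_mx (is_derive_frame A t) (is_derive_frame1 A t). Qed.

Lemma is_derive1_unique (V : normedModType R) (f : R -> V) t d :
  is_derive t 1 f d -> derive1 f t = d.
Proof. by move=> df; rewrite derive1E; apply: derive_val. Qed.

Lemma spans_change A B l : spans A l -> spans B l ->
  exists2 X : R -> 'M[R]_n, (forall t, derivable X t 1) &
    forall t, B t = A t *m X t.
Proof.
move=> sA sB.
(* A pointwise choice of [X t] would carry no regularity. The upper block of [(A|A')^-1 B] is
   derivable by construction, and equals the change of frame because [B t] lies in the span of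
   [A t]. *)
pose X t : 'M[R]_n :=
  row_mx 1%:M 0 *m (invmx (row_mx (A t) (derive1 A t)) *m B t).
exists X => t.
  have dV : derivable (fun x => invmx (row_mx (A x) (derive1 A x))) t 1.
    apply: derivable_invmx => [x|]; first exact: frame_fanning.
    by case: (is_derive_frame_jet A t).
  have [//] := is_derive_mulmxr (row_mx 1%:M 0)
    (is_derive_mulmx (derivableP dV) (is_derive_frame B t)).
have /colspanS[Y BE] : (colspan (B t) <= colspan (A t))%VS.
  by rewrite -sA -sB.
rewrite /X BE; congr (_ *m _).
have -> : A t *m Y = row_mx (A t) (derive1 A t) *m col_mx Y 0.
  by rewrite mul_row_col mulmx0 addr0.
by rewrite mulKmx ?frame_fanning// mul_row_col mul1mx mul0mx addr0.
Qed.

Definition fundamental_endo A t : 'M[R]_(n + n) :=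
  row_mx 0 (A t) *m invmx (row_mx (A t) (derive1 A t)).

Lemma fundamental_endo_frame A t :
  fundamental_endo A t *m A t = 0 /\ fundamental_endo A t *m derive1 A t = A t.
Proof.
by apply: eq_row_mx; rewrite -mul_mx_row mulmxKV ?frame_fanning.
Qed.

(** Independence of the frame: if [B = A X], then [B' = A' X + A X'], and [F] kills the second term,
    so [F B' = A X = B]. *)
Lemma fundamental_endoP A l : spans A l ->
  is_fundamental_endomorphism l (fundamental_endo A).
Proof.
move=> sA B sB t; have [X dX BE] := spans_change sA sB.
have [FA FA1] := fundamental_endo_frame A t.
have -> : derive1 B t = derive1 A t *m X t + A t *m derive1 X t.
  rewrite (_ : frame_fun B = fun x => A x *m X x); last exact/funext.
  apply/is_derive1_unique/is_derive_mulmx; first exact: is_derive_frame.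
  by rewrite derive1E; apply: derivableP.
by rewrite BE mulmxDr !mulmxA FA FA1 !mul0mx addr0.
Qed.

Lemma fundamental_endo_unique l A F : spans A l ->
  is_fundamental_endomorphism l F -> F = fundamental_endo A.
Proof.
move=> sA FP; apply/funext => t; have [FA FA1] := FP A sA t.
have MF : F t *m row_mx (A t) (derive1 A t) = row_mx 0 (A t).
  by rewrite mul_mx_row FA FA1.
by rewrite /fundamental_endo -MF mulmxK ?frame_fanning.
Qed.

Lemma is_derive_fundamental_endo A t :
  is_derive t 1 (fundamental_endo A) (derive1 (fundamental_endo A) t).
Proof.
rewrite derive1E; apply: derivableP.
have dV : derivable (fun x => invmx (row_mx (A x) (derive1 A x))) t 1.
  apply: derivable_invmx => [x|]; first exact: frame_fanning.
  by case: (is_derive_frame_jet A t).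
have [//] := is_derive_mulmx (is_derive_row_mx
  (is_derive_cst (0 : 'M[R]_(n + n, n)) t 1) (is_derive_frame A t))
  (derivableP dV).
Qed.

Lemma horizontal_space_fundamental A t :
  val (horizontal_space (frame_two_jet_at A t)) =
  passmx.leigenspace (matrix_endo (derive1 (fundamental_endo A) t)) 1.
Proof.
have dF := is_derive_fundamental_endo A t.
set G := derive1 (fundamental_endo A) t in dF *.
have [FA FA1] := fundamental_endo_frame A t.
have uM := frame_fanning A t.
have [P [Q A2E]] := row_mx_decomp (derive1n 2 A t) uM.
have GA : G *m A t = - A t.
  apply/eqP; rewrite -addr_eq0 -{2}FA1.
  have := is_derive1_unique (is_derive_mulmx dF (is_derive_frame A t)).
  under eq_fun do rewrite (fundamental_endo_frame _ _).1.
  by rewrite derive1_cst => <-.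
(* Differentiating [F A' = A] gives [G A' + F A'' = A'], and [F A'' = A Q] since [F] kills [A P] and
   sends [A' Q] to [A Q]. *)
have GA1 : G *m derive1 A t = derive1 A t - A t *m Q.
  apply/eqP; rewrite -subr_eq opprK; apply/eqP.
  have := is_derive1_unique (is_derive_mulmx dF (is_derive_frame1 A t)).
  under eq_fun do rewrite (fundamental_endo_frame _ _).2.
  by move=> A1E; rewrite [RHS]A1E A2E mulmxDr !mulmxA FA FA1 mul0mx add0r.
rewrite /= (horizontal_frameE uM A2E).
(* [G] reverses the sign of [A Q / 2], so [G H = A' - A Q + A Q / 2 = H]. *)
set H := _ - _; have GH : G *m H = H.
  rewrite /H mulmxBr GA1 -scalemxAr mulmxA GA mulNmx scalerN opprK.
  rewrite -addrA; congr (_ + _); rewrite -[X in - X + _]scale1r -scaleNr -scalerDl.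
  by rewrite -scaleNr; congr (_ *: _); field.
apply/vspaceP => v; rewrite memv_leigenspace1.
apply/memv_colspan/eqP => [[u ->]|Gv]; first by rewrite mulmxA GH.
(* Conversely, write a fixed vector as [v = A a + H b]. Then [G v = - A a + H b], so [2 A a = 0] and
   [v = H b]. *)
have := mulKVmx (row_mx_horizontal_unit Q uM) v; rewrite -/H.
rewrite -[X in _ *m X = _]vsubmxK mul_row_col.
set a := usubmx _; set b := dsubmx _ => vE.
have : G *m v = v by [].
rewrite -vE mulmxDr !mulmxA GA GH => /addIr /eqP.
rewrite mulNmx eq_sym -subr_eq0 opprK -mulr2n -scaler_nat scaler_eq0 pnatr_eq0.
move=> /eqP Aa.
by exists b; rewrite Aa add0r.
Qed.

(** Both sides are eigenspaces of the derivative of one and the same fundamental endomorphism, that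
    of [l]. This avoids comparing the two-jets of [A] and [B], which would involve the second
    derivative of the change of frame. *)
Lemma horizontal_space_spans A B l t : spans A l -> spans B l ->
  horizontal_space (frame_two_jet_at A t) = horizontal_space (frame_two_jet_at B t).
Proof.
move=> sA sB; apply: val_inj; rewrite !horizontal_space_fundamental.
by rewrite (fundamental_endo_unique sB (fundamental_endoP sA)).
Qed.

End FundamentalEndomorphism.

(** * Linear images of frames, and lines *)

Section Frames.
Variables (R : realType) (n : nat).

Lemma curve_of_frame_subproof (A : fanning_frame R n) (t : R) :
  \dim (colspan (A t)) == n.
Proof. exact/eqP/dim_colspan_lsub/(frame_fanning A t). Qed.

Definition curve_of_frame (A : fanning_frame R n) : fanning_curve R n :=
  @FanningCurve R n
    (fun t => exist _ (colspan (A t)) (curve_of_frame_subproof A t))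
    (ex_intro _ A (fun t => erefl)).

Lemma derive1n_mulmxr (m p q : nat) (T : 'M[R]_(m, p)) (A : R -> 'M[R]_(p, q)) :
  smooth_curve A ->
  forall k, derive1n k (fun t => T *m A t) = (fun t => T *m derive1n k A t).
Proof.
move=> sA; elim=> [|k IH]; first by rewrite !derive1n0.
rewrite !derive1nS IH; apply/funext => t; apply: is_derive1_unique.
by apply: is_derive_mulmxr; rewrite derive1E; exact: derivableP.
Qed.

Lemma mulmx_frame_smooth (T : 'M[R]_(n + n)) (A : fanning_frame R n) :
  smooth_curve (fun t => T *m A t).
Proof.
move=> k t; rewrite derive1n_mulmxr; last exact: frame_smooth.
by have [] := is_derive_mulmxr T (derivableP (@frame_smooth _ _ A k t)).
Qed.

Lemma derive1_mulmx_frame (T : 'M[R]_(n + n)) (A : fanning_frame R n) t :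
  derive1 (fun t => T *m A t) t = T *m derive1 A t.
Proof. by apply/is_derive1_unique/is_derive_mulmxr/is_derive_frame. Qed.

Lemma mulmx_frame_fanning (T : 'M[R]_(n + n)) (A : fanning_frame R n) :
  T \in unitmx -> forall t,
  row_mx (T *m A t) (derive1 (fun t => T *m A t) t) \in unitmx.
Proof.
move=> uT t.
by rewrite derive1_mulmx_frame -mul_mx_row unitmx_mul uT frame_fanning.
Qed.

Definition mulmx_frame (T : 'M[R]_(n + n)) (uT : T \in unitmx)
    (A : fanning_frame R n) : fanning_frame R n :=
  FanningFrame (@mulmx_frame_smooth T A) (mulmx_frame_fanning A uT).

Lemma derive1_line (B0 B1 : 'M[R]_(n + n, n)) :
  derive1 (fun t : R => B0 + t *: B1) = cst B1.
Proof.
apply/funext => t; apply: is_derive1_unique; apply/is_derive_mxP => i j.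
rewrite (_ : (fun x => _) = (cst (B0 i j) + B1 i j \*: id)); last first.
  by apply/funext => x; rewrite !mxE mulrC.
by apply: is_derive_eq; rewrite add0r /GRing.scale /= mulr1.
Qed.

Lemma derive1n_line (B0 B1 : 'M[R]_(n + n, n)) k :
  derive1n k.+2 (fun t : R => B0 + t *: B1) = cst 0.
Proof.
elim: k => [|k IH]; rewrite derive1nS.
  by rewrite derive1n1 derive1_line; apply/funext => t; rewrite derive1_cst.
by rewrite IH; apply/funext => t; rewrite derive1_cst.
Qed.

Lemma line_smooth (B0 B1 : 'M[R]_(n + n, n)) :
  smooth_curve (fun t : R => B0 + t *: B1).
Proof.
move=> [|[|k]] t; last by rewrite derive1n_line; exact: derivable_cst.
  rewrite derive1n0; apply: derivableD; first exact: derivable_cst.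
  apply/derivable_mxP => i j.
  rewrite (_ : (fun x => _) = (fun x => x * B1 i j)); last first.
    by apply/funext => x; rewrite mxE.
  by apply: derivableM; [exact: derivable_id | exact: derivable_cst].
by rewrite derive1n1 derive1_line; exact: derivable_cst.
Qed.

Lemma row_mx_line_unit (B0 B1 : 'M[R]_(n + n, n)) (t : R) :
  row_mx B0 B1 \in unitmx -> row_mx (B0 + t *: B1) B1 \in unitmx.
Proof.
move=> uM; have -> : row_mx (B0 + t *: B1) B1 =
    row_mx B0 B1 *m block_mx 1%:M 0 t%:M 1%:M.
  by rewrite mul_row_block !mulmx1 mulmx0 add0r mul_mx_scalar.
by rewrite unitmx_mul uM unitmxE det_lblock !det1 mulr1 unitr1.
Qed.

Lemma line_fanning (B0 B1 : 'M[R]_(n + n, n)) : row_mx B0 B1 \in unitmx ->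
  forall t : R, row_mx (B0 + t *: B1) (derive1 (fun t : R => B0 + t *: B1) t)
    \in unitmx.
Proof. by move=> uM t; rewrite derive1_line row_mx_line_unit. Qed.

Definition line_frame (B0 B1 : 'M[R]_(n + n, n)) (uM : row_mx B0 B1 \in unitmx)
    : fanning_frame R n :=
  FanningFrame (@line_smooth B0 B1) (line_fanning uM).

Lemma horizontal_space_mulmx_frame (T : 'M[R]_(n + n)) (uT : T \in unitmx)
    (A : fanning_frame R n) t :
  val (horizontal_space (frame_two_jet_at (mulmx_frame uT A) t)) =
  (matrix_endo T @: val (horizontal_space (frame_two_jet_at A t)))%VS.
Proof.
rewrite /= matrix_endo_colspan derive1_mulmx_frame.
have /= -> := congr1 (@^~ t) (@derive1n_mulmxr _ _ _ T A (@frame_smooth _ _ A) 2).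
by rewrite horizontal_frame_mulmx ?frame_fanning.
Qed.

Lemma horizontal_space_line_frame (B0 B1 : 'M[R]_(n + n, n))
    (uM : row_mx B0 B1 \in unitmx) t :
  val (horizontal_space (frame_two_jet_at (line_frame uM) t)) = colspan B1.
Proof.
rewrite /= derive1_line derive1_cst.
rewrite (@horizontal_frameE _ _ _ _ _ 0 0) ?mulmx0 ?addr0//.
  by rewrite scaler0 subr0.
exact: row_mx_line_unit.
Qed.

(** Reduces uniqueness to lines: under two-jet dependence, the value on any curve at [t] is the
    value on a line at time 0. *)
Lemma frame_jet_class_line (A : fanning_frame R n) t :
  exists2 H : 'M[R]_(n + n, n),
    colspan H = val (horizontal_space (frame_two_jet_at A t)) &
    exists uH : row_mx (A t) H \in unitmx,
      frame_jet_class A t = frame_jet_class (line_frame uH) 0.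
Proof.
have uM := frame_fanning A t.
have [P [Q A2E]] := row_mx_decomp (derive1n 2 A t) uM.
pose H := derive1 A t - 2^-1 *: (A t *m Q).
have uH : row_mx (A t) H \in unitmx by exact: row_mx_horizontal_unit.
exists H; first by rewrite /= (horizontal_frameE uM A2E).
exists uH; apply/eqmodP/asboolP => /=.
(* [X1 = - Q / 2] turns [A'] into [H]; the second derivative then becomes [A'' - A' Q + A X2], and
   [X2 = - P] makes it zero. *)
exists 1%:M, (- (2^-1 *: Q)), (- P).
rewrite unitmx1 /= derive1_line derive1_cst scale0r addr0.
rewrite [derive1 (derive1 A) t]A2E.
split=> //; rewrite !mulmx1 mulmxN -scalemxAr; congr (_, _, _).
rewrite !mulmxN -scalemxAr mulr2n.
by apply/matrixP => i j; rewrite !mxE; field.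
Qed.

(* Commuting with the invertible matrix [1 + E_ii] makes the [i]-th basis vector
   an eigenvector of [S]; its eigenvalue [c] vanishes, else [1 - c^-1 S] would be
   singular. *)
Lemma comm_units_eq0 (S : 'M[R]_n) :
  (forall X, X \in unitmx -> X *m S = S *m X) ->
  (forall s : R, 1%:M - s *: S \in unitmx) -> S = 0.
Proof.
move=> cS uS; apply/matrixP => k i; rewrite mxE.
pose e : 'cV[R]_n := delta_mx i 0.
have Se : S *m e = S i i *: e.
  have uE : (1%:M + delta_mx i i : 'M[R]_n) \in unitmx.
    have /mulmx1_unit[] // : (1%:M + delta_mx i i) *m
        (1%:M - 2^-1 *: delta_mx i i) = 1%:M :> 'M[R]_n.
    rewrite mulmxBr mulmx1 mulmxDl mul1mx -scalemxAr mul_delta_mx.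
    by apply/matrixP => k' l; rewrite !mxE; field.
  have /(congr1 (mulmx^~ e)) := cS _ uE.
  rewrite mulmxDl mulmxDr mul1mx mulmx1 !mulmxDl => /addrI.
  rewrite -!mulmxA [delta_mx i i *m e]mul_delta_mx => <-.
  rewrite -(mul_delta_mx (0 : 'I_1) i i) -mulmxA [delta_mx 0 i *m _]mulmxA.
  rewrite -rowE -colE -mul_mx_scalar; congr (_ *m _).
  by apply/matrixP => a b; rewrite !ord1 !mxE.
have [c0|c_neq0] := eqVneq (S i i) 0.
  by move/matrixP: Se => /(_ k 0); rewrite c0 scale0r -colE !mxE.
have e0 : e = 0.
  apply: (can_inj (mulKmx (uS (S i i)^-1))).
  by rewrite mulmx0 mulmxBl mul1mx -scalemxAl Se scalerA mulVf// scale1r subrr.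
by move/matrixP: e0 => /(_ i 0)/eqP; rewrite !mxE !eqxx oner_eq0.
Qed.

End Frames.

(** * Characterization of the horizontal curve *)

Section Uniqueness.
Variables (R : realType) (n : nat).

Lemma row_mx_coord_inj (A B : 'M[R]_(n + n, n)) (P Q P' Q' : 'M[R]_n) :
  row_mx A B \in unitmx ->
  A *m P + B *m Q = A *m P' + B *m Q' -> P = P' /\ Q = Q'.
Proof.
by move=> uM; rewrite -!mul_row_col => /(can_inj (mulKmx uM))/eq_col_mx.
Qed.

(** Such a [T] sends [B0 + s B1] to [(B0 + s B1) X], so it fixes every subspace of the curve spanned
    by the line. *)
Lemma line_equivariance (B0 B1 : 'M[R]_(n + n, n)) (X : 'M[R]_n) :
  row_mx B0 B1 \in unitmx -> X \in unitmx ->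
  exists2 T : 'M[R]_(n + n), T \in unitmx & T *m B0 = B0 *m X /\ T *m B1 = B1 *m X.
Proof.
move=> uM uX; exists (row_mx (B0 *m X) (B1 *m X) *m invmx (row_mx B0 B1)).
  have -> : row_mx (B0 *m X) (B1 *m X) = row_mx B0 B1 *m block_mx X 0 0 X.
    by rewrite mul_row_block !mulmx0 addr0 add0r.
  rewrite !unitmx_mul uM unitmx_inv uM andbT unitmxE det_ublock unitrM.
  by move: uX; rewrite unitmxE => ->.
by apply: eq_row_mx; rewrite -mul_mx_row mulmxKV.
Qed.

Lemma four_properties_line (h : assignment R n) (B0 B1 : 'M[R]_(n + n, n))
    (uM : row_mx B0 B1 \in unitmx) :
  four_properties h ->
  val (h (curve_of_frame (line_frame uM)) 0) = colspan B1.
Proof.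
move=> [transh _ equivh consth]; set l := curve_of_frame _.
have [C CW] := colspan_of_vspace (eqP (valP (h l 0))).
(* By constancy the single subspace spanned by [C] is transversal to the curve at every time [s]. *)
have transC s : row_mx C (B0 + s *: B1) \in unitmx.
  have hs : h l 0 = h l s by apply: (consth _ _ uM).
  by rewrite -colspan_full colspan_row_mx CW hs -(transh l s).
have [U [V CE]] := row_mx_decomp C uM.
(* Transversality at [s = 0] gives [B1 = C Y + B0 Z]; comparing coefficients of [B1] yields
   [V Y = 1]. Dividing by [V] then normalises the frame to [B0 S + B1]. *)
have uV : V \in unitmx.
  have [Y [Z]] := row_mx_decomp B1 (transC 0).
  rewrite scale0r addr0 => B1E.
  have /(row_mx_coord_inj uM)[_ VY1] :
      B0 *m 0 + B1 *m 1%:M = B0 *m (U *m Y + Z) + B1 *m (V *m Y).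
    rewrite mulmx0 mulmx1 add0r {1}B1E CE mulmxDl mulmxDr !mulmxA.
    by rewrite -!addrA [B0 *m Z + _]addrC.
  by case: (mulmx1_unit (esym VY1)).
have [S DE] : exists S, C *m invmx V = B0 *m S + B1.
  by exists (U *m invmx V); rewrite CE mulmxDl mulmxK // mulmxA.
pose D := B0 *m S + B1.
have colD : colspan D = val (h l 0).
  by rewrite /D -DE colspan_mulmxr ?unitmx_inv.
suff S0 : S = 0 by rewrite -colD /D S0 mulmx0 add0r.
apply: comm_units_eq0 => [X uX|s].
  have [T uT [TB0 TB1]] := line_equivariance uM uX.
  (* Since [T] maps the curve to itself, equivariance can be applied with [l] as its own image. The
     span of [D] is therefore invariant, and [T D = D Y] gives [Y = X] on the [B1] part, hence
     [X S = S X] on the [B0] part. *)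
  have Tl t : val (l t) = (matrix_endo T @: val (l t))%VS.
    rewrite /= matrix_endo_colspan mulmxDr -scalemxAr TB0 TB1.
    by rewrite scalemxAl -mulmxDl colspan_mulmxr.
  have := equivh T uT l l Tl 0; rewrite -colD matrix_endo_colspan => TD.
  have /colspanS[Y] : (colspan (T *m D) <= colspan D)%VS by rewrite -TD.
  rewrite /D mulmxDr mulmxDl mulmxA TB0 TB1 -!mulmxA.
  by case/(row_mx_coord_inj uM) => XS XY; rewrite XS XY.
have uD : row_mx D (B0 + s *: B1) \in unitmx.
  by rewrite -colspan_full colspan_row_mx colD -CW -colspan_row_mx colspan_full.
(* From [B0 = D Y + (B0 + s B1) Z] the coefficients give [S Y + Z = 1] and [Y + s Z = 0], so [Z] is
   an inverse of [1 - s S]. *)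
have [Y [Z B0E]] := row_mx_decomp B0 uD.
have /(row_mx_coord_inj uM)[Y1 Y2] :
    B0 *m 1%:M + B1 *m 0 = B0 *m (S *m Y + Z) + B1 *m (Y + s *: Z).
  rewrite mulmx1 mulmx0 addr0 {1}B0E /D !mulmxDl -scalemxAl scalemxAr.
  by rewrite -mulmxA addrACA -!mulmxDr.
have YE : Y = - (s *: Z) by apply/eqP; rewrite -addr_eq0 -Y2.
suff: (1%:M - s *: S) *m Z = 1%:M by case/mulmx1_unit.
by rewrite [RHS]Y1 YE mulmxBl mul1mx mulmxN -scalemxAr -scalemxAl addrC.
Qed.

(** * The horizontal curve as an assignment: four properties and uniqueness *)

Definition curve_frame (l : fanning_curve R n) : fanning_frame R n :=
  sval (cid (curve_fanning l)).

Lemma curve_frame_spans (l : fanning_curve R n) : spans (curve_frame l) l.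
Proof. exact: svalP (cid (curve_fanning l)). Qed.

(** The spanning frame is picked by choice; [horizontal_curveE] shows that any other spanning frame
    gives the same value. *)
Definition horizontal_curve : assignment R n :=
  fun l t => horizontal_space (frame_two_jet_at (curve_frame l) t).

Lemma horizontal_curveE (l : fanning_curve R n) (A : fanning_frame R n) t :
  spans A l -> horizontal_curve l t = horizontal_space (frame_two_jet_at A t).
Proof. exact/horizontal_space_spans/curve_frame_spans. Qed.

Lemma horizontal_curveP (l : fanning_curve R n) :
  is_horizontal_curve l (horizontal_curve l).
Proof.
exists (fundamental_endo (curve_frame l)).
  exact/fundamental_endoP/curve_frame_spans.
by move=> t; rewrite -horizontal_space_fundamental.
Qed.

Lemma horizontal_curve_transversal : transversality horizontal_curve.
Proof.
move=> l t; apply/eqP; rewrite curve_frame_spans addvC -colspan_row_mx colspan_full.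
exact/row_mx_horizontal_frame_unit/frame_fanning.
Qed.

Lemma horizontal_curve_two_jet : two_jet_dependence horizontal_curve.
Proof.
(* The map [j] evaluates on a chosen representative, which is harmless because [horizontal_space] is
   constant on equivalence classes. *)
exists (fun q => horizontal_space (repr q)) => l A sA t.
rewrite (horizontal_curveE t sA); apply: horizontal_space_equiv.
by apply/eqmodP; rewrite reprK.
Qed.

Lemma horizontal_curve_equivariant : linear_equivariance horizontal_curve.
Proof.
move=> T uT l Tl TlE t; rewrite -(horizontal_space_mulmx_frame uT).
congr val; apply: horizontal_curveE => s.
by rewrite TlE curve_frame_spans matrix_endo_colspan.
Qed.

Lemma horizontal_curve_constant : constant_on_lines horizontal_curve.
Proof.
move=> B0 B1 uM l sl s t; apply: val_inj.
have sA : spans (line_frame uM) l by exact: sl.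
by rewrite !(horizontal_curveE _ sA) !horizontal_space_line_frame.
Qed.

Lemma four_properties_horizontal_curve (h : assignment R n) :
  four_properties h -> forall l t, h l t = horizontal_curve l t.
Proof.
move=> hP l t; have [_ [j jE] _ _] := hP.
(* [j] is used in both directions: from [l] at [t] to its two-jet, then from the equal two-jet of a
   line at 0 to the value of [h] on that line. *)
rewrite (jE l _ (curve_frame_spans l)).
have [H HE [uH ->]] := frame_jet_class_line (curve_frame l) t.
rewrite -(jE (curve_of_frame (line_frame uH)))//.
by apply: val_inj; rewrite four_properties_line.
Qed.

End Uniqueness.

Theorem theorem1p3 (R : realType) (n : nat) :
  exists h : assignment R n,
    (forall l : fanning_curve R n, is_horizontal_curve l (h l)) /\
    four_properties h /\
    (forall h' : assignment R n, four_properties h' ->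
       forall (l : fanning_curve R n) (t : R), h' l t = h l t).
Proof.
exists (@horizontal_curve R n); split; first exact: horizontal_curveP.
split; last exact: four_properties_horizontal_curve.
split; [exact: horizontal_curve_transversal|exact: horizontal_curve_two_jet|
  exact: horizontal_curve_equivariant|exact: horizontal_curve_constant].
Qed.
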